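(* Let $G$ be a finite group or a compact Lie group, let $\mathcal{H}_B$ be a Hilbert space of finite dimension $d$ with orthonormal basis $\{|i\rangle\}_{i=1}^{d}$, and let $\mathcal{R},\mathcal{L}:G\to\mathsf{U}(\mathcal{H}_B)$ be projective unitary representations with multipliers $\gamma$ and $\gamma^{-1}$ respectively. Let $B=\{B^i\}_{i=1}^{d}$ be a tensor of square matrices in canonical form II (CFII), written in terms of a basis of normal tensors (BNT) as $$B^i=\bigoplus_{j=1}^m\bigoplus_{q=1}^{r_j}\mu_{j,q}B^i_j ,$$ where $\{B_j\}_{j=1}^m$ is a BNT of $B$ consisting of normal tensors in CFII and $\mu_{j,q}$ are nonzero constants. Suppose that the matrix product vector generated by $B$ has a local symmetry with respect to $\mathcal{R}(g)\otimes\mathcal{L}(g)$: for all $N\ge 2$, any two neighboring sites $K,K+1$ of the periodic chain of length $N$, and all $g\in G$, $$\mathcal{R}(g)^{[K]}\otimes\mathcal{L}(g)^{[K+1]}|\psi^N_B\rangle=|\psi^N_B\rangle .$$ Then there exists a projective representation $X(g)$ of $G$ with the same multiplier $\gamma$ as $\mathcal{R}(g)$ and with the same block structure as $B$, $$X(g)=\bigoplus_{j=1}^m\bigoplus_{q=1}^{r_j}X_j(g)$$ (with $X_j(g)$ of the size of the matrices $B_j^i$), such that for all $g\in G$ and all $i$, $$\sum_{i'}\mathcal{R}(g)_{i,i'}B^{i'}=B^iX(g),\qquad \sum_{i'}\mathcal{L}(g)_{i,i'}B^{i'}=X(g)^{-1}B^i .$$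
   Context: A multiplier of $G$ is a function $\gamma:G\times G\to U(1)$ with $\gamma(g,h)\gamma(gh,f)=\gamma(g,hf)\gamma(h,f)$ and $\gamma(g,e)=\gamma(e,g)=1$ (continuous if $G$ is a compact Lie group). A projective unitary representation with multiplier $\gamma$ on a finite-dimensional Hilbert space is a map $\Theta$ from $G$ to unitaries with $\Theta(g)\Theta(h)=\gamma(g,h)\Theta(gh)$. All (projective) representations are unitary and finite dimensional. Matrix elements are $\mathcal{R}(g)_{i,i'}=\langle i|\mathcal{R}(g)|i'\rangle$, and similarly for $\mathcal{L}$; a superscript $[K]$ indicates the tensor factor on which an operator acts. A tensor $B=\{B^i\}_{i=1}^d$ of $D\times D$ complex matrices generates, for each $N$, the matrix product vector $|\psi_B^N\rangle=\sum_{i_1,\dots,i_N}\operatorname{Tr}(B^{i_1}\cdots B^{i_N})|i_1\dots i_N\rangle\in\mathcal{H}_B^{\otimes N}$. The associated completely positive map is $E_B(X)=\sum_{i=1}^dB^iX(B^i)^\dagger$. A tensor is normal if for some $L$ the $L$-fold products of its matrices span the full matrix algebra, and its CP map has spectral radius $1$. A tensor is in canonical form (CF) if it is of the form $\bigoplus_k\nu_kB_k^i$ with $B_k$ normal tensors and $\nu_k$ constants; it is in canonical form II (CFII) if in addition each $E_{B_k}$ is trace preserving and has a diagonal, positive definite (full rank) fixed point. A basis of normal tensors (BNT) of a tensor $\bigoplus_k\nu_kB_k$ in CF is a set of normal tensors $\{\hat B_j\}$ such that for every $k$ there exist a unique $\hat B_j$, an invertible matrix $V$ and a phase $e^{i\phi}$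 with $B_k^i=e^{i\phi}V^{-1}\hat B_j^iV$ for all $i$. *)

(* Defs.v *)
From HB Require Import structures.
From mathcomp Require Import all_boot all_order all_algebra.
From mathcomp Require Import all_classical all_reals all_analysis.
From mathcomp Require Export complex.

Set Implicit Arguments.
Unset Strict Implicit.
Unset Printing Implicit Defensive.

Import Order.TTheory GRing.Theory Num.Theory numFieldNormedType.Exports.

Local Open Scope classical_set_scope.
Local Open Scope sesquilinear_scope.
Local Open Scope ring_scope.

HB.mixin Record isTopologicalGroup G of Group G & Topological G := {
  mulg_continuous : continuous (fun p : G * G => (p.1 * p.2)%g);
  invg_continuous : continuous (fun g : G => (g^-1)%g)
}.

#[short(type="topGroupType")]
HB.structure Definition TopologicalGroup :=
  {G of Group G & Topological G & isTopologicalGroup G}.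

Section Lie.
Variable R : realType.

(* All iterated partial derivatives of order at most k exist and are
   continuous at the points of U. Only used for U open, so that the values of
   f outside U are irrelevant. *)
Fixpoint Ck_on (k n p : nat) (U : set 'rV[R]_n) (f : 'rV[R]_n -> 'rV[R]_p) :=
  (forall x, U x -> {for x, continuous f}) /\
  if k is k'.+1 then
    forall i : 'I_n, (forall x, U x -> derivable f x (delta_mx 0 i)) /\
      Ck_on k' U (fun x => 'D_(delta_mx 0 i) f x)
  else True.

Definition smooth_on n p (U : set 'rV[R]_n) (f : 'rV[R]_n -> 'rV[R]_p) :=
  forall k, Ck_on k U f.

(* A homeomorphism cmap from the open set cdom onto an open subset of R^n; the
   values of cmap and cinv off these two sets are irrelevant. *)
Record chart (T : topologicalType) (n : nat) := Chart {
  cdom : set T;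
  cmap : T -> 'rV[R]_n;
  cinv : 'rV[R]_n -> T;
  cdom_open : open cdom;
  cimg_open : open (cmap @` cdom);
  cmapK : forall x, cdom x -> cinv (cmap x) = x;
  cmap_cont : forall x, cdom x -> {for x, continuous cmap};
  cinv_cont : forall y, (cmap @` cdom) y -> {for y, continuous cinv}
}.

Definition cimg T n (c : chart T n) : set 'rV[R]_n := cmap c @` cdom c.

Definition smooth_atlas (T : topologicalType) n (A : set (chart T n)) :=
  (forall x, exists2 c, A c & cdom c x) /\
  (forall c c', A c -> A c' ->
     smooth_on (cmap c @` (cdom c `&` cdom c')) (cmap c' \o cinv c)).

(* Points of R^n x R^n are encoded as row vectors of length n + n. *)
Definition smooth_mul (G : topGroupType) n (A : set (chart G n)) :=
  forall c1 c2 c3, A c1 -> A c2 -> A c3 ->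
    let mul (z : 'rV[R]_(n + n)) :=
      (cinv c1 (lsubmx z) * cinv c2 (rsubmx z))%g in
    smooth_on [set z | [/\ cimg c1 (lsubmx z), cimg c2 (rsubmx z)
                         & cdom c3 (mul z)]]
              (fun z => cmap c3 (mul z)).

Definition smooth_inv (G : topGroupType) n (A : set (chart G n)) :=
  forall c1 c2, A c1 -> A c2 ->
    let inv (y : 'rV[R]_n) := ((cinv c1 y)^-1)%g in
    smooth_on [set y | cimg c1 y /\ cdom c2 (inv y)]
              (fun y => cmap c2 (inv y)).

Definition Lie_group (G : topGroupType) :=
  [/\ hausdorff_space G, @second_countable G &
      exists n (A : set (chart G n)),
        [/\ smooth_atlas A, smooth_mul A & smooth_inv A]].

Definition compact_Lie_group (G : topGroupType) :=
  Lie_group G /\ compact [set: G].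

Definition finite_discrete_group (G : topGroupType) :=
  finite_set [set: G] /\ forall A : set G, open A.

End Lie.

Section Projective.
Variables (C : numClosedFieldType) (G : topGroupType).

(* Continuity is vacuous when G is discrete. *)
Definition multiplier (gam : G -> G -> C) :=
  [/\ forall g h, `|gam g h| = 1,
      forall g h f,
        gam g h * gam (g * h)%g f = gam g (h * f)%g * gam h f,
      forall g, gam g 1%g = 1 /\ gam 1%g g = 1
    & continuous (fun p : G * G => gam p.1 p.2)].

Definition proj_rep n (gam : G -> G -> C) (Theta : G -> 'M[C]_n) :=
  (forall g, Theta g \is unitarymx) /\
  (forall g h, Theta g *m Theta h = gam g h *: Theta (g * h)%g).

Definition continuous_rep n (Theta : G -> 'M[C]_n) := continuous Theta.

End Projective.

Definition tensor (C : Type) (d D : nat) := 'I_d -> 'M[C]_D.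

Section Tensors.
Variables (C : numClosedFieldType) (d : nat).

(* The product basis vectors |i_1 ... i_N> of the N-fold tensor power. *)
Definition config (N : nat) := {ffun 'I_N -> 'I_d}.

(* Vectors of the N-fold tensor power of C^d, by their coordinates. *)
Definition state (N : nat) := {ffun config N -> C}.

Definition word D (B : tensor C d D) N (s : config N) : 'M[C]_D :=
  \prod_(k < N) B (s k).

Definition mpv D (B : tensor C d D) N : state N := 
  [ffun s : config N => \tr (word B s)].

Definition upd N (s : config N) (K : 'I_N) (a : 'I_d) : config N :=
  [ffun k => if k == K then a else s k].

(* The operator A acting on the tensor factor K. *)
Definition site_op N (A : 'M[C]_d) (K : 'I_N) (psi : state N) : state N :=
  [ffun s : config N => \sum_a A (s K) a * psi (upd s K a)].

Definition cp_map D (B : tensor C d D) (X : 'M[C]_D) : 'M[C]_D :=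
  \sum_i B i *m X *m (B i)^t*.

Definition map_eigenvalue D (E : 'M[C]_D -> 'M[C]_D) (a : C) :=
  exists2 X, X != 0 & E X = a *: X.

Definition has_spectral_radius D (E : 'M[C]_D -> 'M[C]_D) (rho : C) :=
  (exists2 a, map_eigenvalue E a & `|a| = rho) /\
  (forall a, map_eigenvalue E a -> `|a| <= rho).

Definition normal_tensor D (B : tensor C d D) :=
  (exists2 L, (0 < L)%N &
     <<[seq word B s | s : config L]>>%VS = fullv) /\
  has_spectral_radius (cp_map B) 1.

Definition trace_preserving D (E : 'M[C]_D -> 'M[C]_D) :=
  forall X, \tr (E X) = \tr X.

(* The conditions that canonical form II imposes on each normal block B_k of
   a direct sum of the nu_k B_k; the constants nu_k are unconstrained. *)
Definition normal_CFII D (B : tensor C d D) :=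
  [/\ normal_tensor B, trace_preserving (cp_map B) &
      exists2 lam : 'rV[C]_D, (forall k, 0 < lam 0 k) &
        cp_map B (diag_mx lam) = diag_mx lam].

(* A i = e^{i phi} V^-1 (B i) V. The bond dimensions of A and B are not
   assumed equal beforehand, whence the two-sided inverse W of V. *)
Definition gauge_phase_equiv D D' (A : tensor C d D) (B : tensor C d D') :=
  exists (V : 'M[C]_(D', D)) (W : 'M[C]_(D, D')) (c : C),
    [/\ V *m W = 1%:M, W *m V = 1%:M, `|c| = 1
      & forall i, A i = c *: (W *m B i *m V)].

(* Bhat is a basis of normal tensors for the canonical form whose normal
   blocks (stripped of the constants nu_k) are the A k. *)
Definition BNT (K : Type) (D : K -> nat) (A : forall k, tensor C d (D k))
    (m : nat) (Dh : 'I_m -> nat) (Bhat : forall j, tensor C d (Dh j)) :=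
  (forall j, normal_tensor (Bhat j)) /\
  (forall k, exists! j, gauge_phase_equiv (A k) (Bhat j)).

End Tensors.

(* The direct sum over j < m and q < r j of the matrices M j q. *)
Definition dsum (C : numClosedFieldType) (m : nat) (r D : 'I_m -> nat)
    (M : forall j, 'I_(r j) -> 'M[C]_(D j)) :
    'M[C]_(\sum_(j < m) \sum_(q < r j) D j) :=
  \mxdiag_(j < m) \mxdiag_(q < r j) M j q.

(* Main.v *)
(* Let $A_j^i$ and $C_j^i$ be the tensors obtained from $B_j^i$ by applying
   $\mathcal{R}(g)$ and $\mathcal{L}(g)$ to the physical index. By simplicity of
   full matrix algebras, long words in two blocks that are not gauge-phase
   equivalent span the direct sum of the two algebras, so words of one large
   length isolate any single block $j$; its weight $\sum_q \mu_{j,q}^N$ is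
   nonzero for infinitely many $N$. Hence the symmetry of the state gives
   $A_j^a C_j^b = B_j^a B_j^b$. Put $X_j = \sum_i (B_j^i)^\dagger A_j^i$. Trace
   preservation, $\sum_i (B_j^i)^\dagger B_j^i = 1$, gives $X_j C_j^b = B_j^b$,
   and right cancellation against the positive fixed point of $E_{B_j}$ gives
   $A_j^a = B_j^a X_j$. Unitarity and the multiplier of $X_j$ follow by left
   cancellation. *)

Require Import Defs.
From mathcomp Require Import all_boot all_order all_algebra.
From mathcomp Require Import all_classical all_reals all_analysis.

Set Implicit Arguments.
Unset Strict Implicit.
Unset Printing Implicit Defensive.

Import Order.TTheory GRing.Theory Num.Theory numFieldNormedType.Exports.

Local Open Scope classical_set_scope.
Local Open Scope sesquilinear_scope.
Local Open Scope ring_scope.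

(** * Nonvanishing of power sums *)

Section PowerSums.
Variable F : numFieldType.

(** With [p] vanishing exactly at the values [c i] other than [c i0], the sum is a positive integer
    multiple of one nonzero value, which survives in characteristic zero. *)
Lemma horner_sum_nonroot (I : finType) (c : I -> F) (i0 : I) (N0 : nat) :
    (forall i, c i != 0) ->
  exists p : {poly F}, \sum_i ('X^N0 * p).[c i] != 0.
Proof.
move=> c0; set s := undup [seq c i | i <- enum I & c i != c i0].
exists (\prod_(a <- s) ('X - a%:P)).
have sP i : (c i \in s) = (c i != c i0).
  rewrite mem_undup; apply/mapP/idP => [[k]|ni].
    by rewrite mem_filter => /andP[nk _] ->.
  by exists i => //; rewrite mem_filter ni mem_enum.
rewrite (bigID (fun i => c i == c i0)) /= [X in _ + X]big1 ?addr0; last first.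
  move=> i ni; rewrite hornerM; apply/eqP; rewrite mulf_eq0; apply/orP; right.
  by rewrite -/(root _ _) root_prod_XsubC sP.
rewrite (eq_bigr (fun=> ('X^N0 * \prod_(a <- s) ('X - a%:P)).[c i0])); last first.
  by move=> i /eqP->.
rewrite sumr_const -mulr_natl mulf_neq0 //.
  rewrite pnatr_eq0 -lt0n; apply/card_gt0P; exists i0.
  exact: eqxx.
rewrite hornerM hornerXn mulf_neq0 ?expf_neq0 //.
by rewrite -/(root _ _) root_prod_XsubC sP eqxx.
Qed.

(** If all power sums of exponent at least [N0] vanished, then by linearity the values of
    ['X^N0 * p] at the [c i] would sum to zero for every polynomial [p]. *)
Lemma power_sum_neq0 (I : finType) (c : I -> F) (i0 : I) (N0 : nat) :
  (forall i, c i != 0) -> exists2 N, (N0 <= N)%N & \sum_i c i ^+ N != 0.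
Proof.
move=> c0; have [p] := horner_sum_nonroot i0 N0 c0; apply: contra_neqP.
move=> /forall2NP h; under eq_bigr => i _.
  rewrite hornerM hornerXn horner_coef mulr_sumr; over.
rewrite exchange_big big1 //= => k _.
under eq_bigr => i _ do rewrite mulrCA -exprD.
rewrite -mulr_sumr; have [/negP|/negP/negPn/eqP->] := h (N0 + k)%N.
  by rewrite leq_addr.
by rewrite mulr0.
Qed.
End PowerSums.

(** * Spans of words evaluated in all blocks at once *)

Section JointWords.
Variables (C : numClosedFieldType) (d m : nat) (D : 'I_m -> nat).
Variable A : forall j, tensor C d (D j).

(* Linear combinations of words of one fixed length, evaluated in all blocks at
   once. The zero constructor matters only for [d = 0], where no word of
   positive length exists. *)
Inductive word_span : nat -> (forall j, 'M[C]_(D j)) -> Prop :=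
| word_span1 : word_span 0 (fun j => 1%:M)
| word_span0 n : word_span n (fun j => 0)
| word_spanS i n x : word_span n x -> word_span n.+1 (fun j => A j i *m x j)
| word_spanL n a x y : word_span n x -> word_span n y ->
    word_span n (fun j => a *: x j + y j).

Lemma eq_word_span n x y : word_span n x -> (forall j, x j = y j) ->
  word_span n y.
Proof.
by move=> hx e; rewrite (_ : y = x) //; apply: functional_extensionality_dep.
Qed.

Lemma word_spanZ n a x : word_span n x -> word_span n (fun j => a *: x j).
Proof.
move=> hx; apply: eq_word_span (word_spanL a hx (word_span0 n)) _ => j.
by rewrite addr0.
Qed.

Lemma word_spanB n x y : word_span n x -> word_span n y ->
  word_span n (fun j => x j - y j).
Proof.
move=> hx hy; apply: eq_word_span (word_spanL (-1) hy hx) _ => j.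
by rewrite scaleN1r addrC.
Qed.

Lemma word_span_sum (I : Type) (s : seq I) n (x : I -> forall j, 'M[C]_(D j)) :
  (forall i, word_span n (x i)) -> word_span n (fun j => \sum_(i <- s) x i j).
Proof.
move=> hx; elim: s => [|i s IH].
  by apply: eq_word_span (word_span0 n) _ => j; rewrite big_nil.
apply: eq_word_span (word_spanL 1 (hx i) IH) _ => j.
by rewrite big_cons scale1r.
Qed.

Lemma word_spanM n p x y : word_span n x -> word_span p y ->
  word_span (n + p) (fun j => x j *m y j).
Proof.
move=> hx hy; elim: hx => {n x} [|n|i n x _ IH|n a x z _ IHx _ IHz].
- by apply: eq_word_span hy _ => j; rewrite mul1mx.
- by apply: eq_word_span (word_span0 _) _ => j; rewrite mul0mx.
- by apply: eq_word_span (word_spanS i IH) _ => j; rewrite mulmxA.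
- apply: eq_word_span (word_spanL a IHx IHz) _ => j.
  by rewrite mulmxDl scalemxAl.
Qed.

Lemma word_span_letter i : word_span 1 (fun j => A j i).
Proof. by apply: eq_word_span (word_spanS i word_span1) _ => j; rewrite mulmx1. Qed.

Lemma word_span_seq (s : seq 'I_d) :
  word_span (size s) (fun j => \prod_(i <- s) A j i).
Proof.
elim: s => [|i s IH] /=.
  by apply: eq_word_span word_span1 _ => j; rewrite big_nil.
by apply: eq_word_span (word_spanS i IH) _ => j; rewrite big_cons.
Qed.

(** The first letter of a word is absorbed into the weights [M], so the induction runs with [M]
    general. *)
Lemma trace_word_span_eq0 n x (M : forall j, 'M[C]_(D j)) : word_span n x ->
    (forall s : seq 'I_d, size s = n ->
       \sum_j \tr (M j *m \prod_(i <- s) A j i) = 0) ->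
  \sum_j \tr (M j *m x j) = 0.
Proof.
move=> hx; elim: hx M => {n x} [|n|i n x _ IH|n a x y _ IHx _ IHy] M hM.
- rewrite -[RHS](hM [::]) //; apply: eq_bigr => j _.
  by rewrite big_nil.
- by rewrite big1 // => j _; rewrite mulmx0 mxtrace0.
- under eq_bigr do rewrite mulmxA.
  apply: IH => s ss; rewrite -[RHS](hM (i :: s)) /= ?ss //.
  by apply: eq_bigr => j _; rewrite big_cons -mulmxA.
- under eq_bigr do rewrite mulmxDr -scalemxAr mxtraceD mxtraceZ.
  by rewrite big_split -mulr_sumr /= IHx // IHy // mulr0 addr0.
Qed.

End JointWords.

(** * Adjoints, traces and matrix units *)

Section Adjoint.
Variable C : numClosedFieldType.

Lemma adjmxM m n p (X : 'M[C]_(m, n)) (Y : 'M[C]_(n, p)) :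
  (X *m Y)^t* = Y^t* *m X^t*.
Proof. by rewrite trmx_mul map_mxM. Qed.

Lemma adjmxZ m n a (X : 'M[C]_(m, n)) : (a *: X)^t* = a^* *: X^t*.
Proof. by apply/matrixP => i j; rewrite !mxE rmorphM. Qed.

Lemma adjmx_sum (I : finType) m n (X : I -> 'M[C]_(m, n)) :
  (\sum_i X i)^t* = \sum_i (X i)^t*.
Proof. by rewrite raddf_sum raddf_sum. Qed.

Lemma trace_mul_delta n (M : 'M[C]_n) p q : \tr (M *m delta_mx p q) = M q p.
Proof.
rewrite /mxtrace (bigD1 q) //= big1 ?addr0 => [|i ni]; rewrite mxE.
  rewrite (bigD1 p) //= big1 ?addr0 => [|k nk].
    by rewrite mxE !eqxx mulr1.
  by rewrite mxE (negPf nk) mulr0.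
by rewrite big1 // => k _; rewrite mxE (negPf ni) andbF mulr0.
Qed.

Lemma trace_mul_eq0 n (M : 'M[C]_n) : (forall X, \tr (M *m X) = 0) -> M = 0.
Proof. by move=> h; apply/matrixP => q p; rewrite -trace_mul_delta h mxE. Qed.

Lemma mul_delta_delta n (X : 'M[C]_n) (r p q s : 'I_n) :
  delta_mx r p *m X *m delta_mx q s = X p q *: delta_mx r s.
Proof.
have -> : delta_mx r p *m X = delta_mx r (ord0 : 'I_1) *m row p X.
  by rewrite rowE mulmxA mul_delta_mx.
apply/matrixP => i j; rewrite !mxE (bigD1 q) //= big1 ?addr0 => [|k nk].
  rewrite !mxE big_ord1 !mxE !eqxx andbT /=.
  by case: (i == r); case: (j == s); rewrite !(mul0r, mulr0, mul1r, mulr1).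
by rewrite [delta_mx _ _ _ _]mxE (negPf nk) mulr0.
Qed.

Lemma mx_neq0_entry m n (M : 'M[C]_(m, n)) :
  M != 0 -> exists p q, M p q != 0.
Proof.
apply: contra_neqP => h; apply/matrixP => p q; rewrite mxE.
by apply/eqP/negPn/negP => e; apply: h; exists p, q.
Qed.

(** The trace is the sum of the [|W i k|^2] weighted by the positive [lam 0 k]. *)
Lemma trace_congr_diag_neq0 m n (W : 'M[C]_(m, n)) (lam : 'rV[C]_n) :
  (forall k, 0 < lam 0 k) -> W != 0 -> \tr (W *m diag_mx lam *m W^t*) != 0.
Proof.
move=> lam0 /mx_neq0_entry[p [q Wpq]].
have E : \tr (W *m diag_mx lam *m W^t*) =
    \sum_i \sum_k `|W i k| ^+ 2 * lam 0 k.
  apply: eq_bigr => i _; rewrite mul_mx_diag !mxE; apply: eq_bigr => k _.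
  by rewrite !mxE normCK mulrAC.
have ge0 i k : 0 <= `|W i k| ^+ 2 * lam 0 k.
  by rewrite mulr_ge0 ?exprn_ge0 // ltW.
rewrite E psumr_neq0; last by move=> i _; apply: sumr_ge0.
apply/hasP; exists p; rewrite ?mem_index_enum //=.
rewrite lt_def sumr_ge0 // andbT psumr_neq0 //.
apply/hasP; exists q; rewrite ?mem_index_enum //=.
by rewrite mulr_gt0 ?exprn_gt0 ?normr_gt0.
Qed.

Lemma commutes_all_scalar n (u : 'M[C]_n) :
  (forall x, u *m x = x *m u) -> exists c, u = c%:M.
Proof.
case: n u => [|n] u hu; first by exists 0; apply/matrixP => -[].
exists (u 0 0); apply/matrixP => p q.
have /matrixP/(_ p 0) := hu (delta_mx q 0).
rewrite !mxE (bigD1 q) //= big1 ?addr0 => [|k nk]; last first.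
  by rewrite mxE (negPf nk) mulr0.
rewrite (bigD1 0) //= big1 ?addr0 => [|k nk]; last first.
  by rewrite mxE (negPf nk) andbF mul0r.
by rewrite !mxE !eqxx mulr1 andbT => ->; rewrite mulr_natl.
Qed.

End Adjoint.

(** * Trace preservation and gauge phases *)

Section NormalTensors.
Variables (C : numClosedFieldType) (d : nat).

(** This is unitality of the dual map, obtained by pairing with every [X] under the trace. *)
Lemma trace_preserving_sum D (B : tensor C d D) :
  trace_preserving (cp_map B) -> \sum_i (B i)^t* *m B i = 1%:M.
Proof.
move=> tp; apply/eqP; rewrite -subr_eq0; apply/eqP/trace_mul_eq0 => X.
rewrite mulmxBl mul1mx raddfB /= -(tp X) /cp_map mulmx_suml.
rewrite !(raddf_sum mxtrace) -sumrB big1 //=.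
by move=> i _; rewrite -(mulmxA _ (B i)) mxtrace_mulC subrr.
Qed.

(** The spectral radius is attained at a nonzero eigenvector, which excludes bond dimension zero. *)
Lemma normal_tensor1_neq0 D (B : tensor C d D) :
  normal_tensor B -> (1%:M : 'M[C]_D) != 0.
Proof.
case=> _ [[a [X X0 _] _] _]; apply: contraNneq X0 => e.
by rewrite -[X]mul1mx e mul0mx.
Qed.

Lemma gauge_phase_equiv_refl D (B : tensor C d D) : gauge_phase_equiv B B.
Proof.
exists 1%:M, 1%:M, 1; rewrite !mulmx1 normr1; split => // i.
by rewrite mul1mx mulmx1 scale1r.
Qed.

(** Transporting the fixed point of [cp_map B] by [W] gives a [Y] of nonzero trace that [cp_map A]
    scales by [|c|^2]; trace preservation forces this factor to be 1. *)
Lemma gauge_equiv_norm1 D D' (A : tensor C d D) (B : tensor C d D')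
    (V : 'M[C]_(D', D)) (W : 'M[C]_(D, D')) (c : C) :
    normal_CFII A -> normal_CFII B -> V *m W = 1%:M ->
    (forall i, A i = c *: (W *m B i *m V)) ->
  `|c| = 1.
Proof.
move=> [_ tpA _] [nB _ [lam lam0 fixB]] VW hA.
have W0 : W != 0.
  by apply: contraNneq (normal_tensor1_neq0 nB) => W0; rewrite -VW W0 mulmx0.
set Y := W *m diag_mx lam *m W^t*.
have Y0 : \tr Y != 0 by apply: trace_congr_diag_neq0.
have WV : W^t* *m V^t* = 1%:M.
  by rewrite -adjmxM VW trmx1 map_mx1.
have EY : cp_map A Y = `|c| ^+ 2 *: Y.
  rewrite /Y -[in RHS]fixB /cp_map mulmx_sumr mulmx_suml scaler_sumr.
  apply: eq_bigr => i _; rewrite hA adjmxZ -scalemxAr -!scalemxAl scalerA.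
  rewrite normCK mulrC; congr (_ *: _); rewrite !adjmxM !mulmxA.
  rewrite -[W *m B i *m V *m W]mulmxA VW mulmx1.
  by rewrite -[_ *m W^t* *m V^t*]mulmxA WV mulmx1.
have /eqP := tpA Y; rewrite EY mxtraceZ -subr_eq0 -[X in _ - X]mul1r -mulrBl.
rewrite mulf_eq0 (negPf Y0) orbF subr_eq0.
by rewrite sqrp_eq1 // => /eqP.
Qed.

End NormalTensors.

(** * Separation of inequivalent blocks *)

Section Separation.
Variables (C : numClosedFieldType) (d m : nat) (D : 'I_m -> nat).
Variable A : forall j, tensor C d (D j).
Local Notation word_span := (word_span A).

Definition full_at n j := forall a, exists x, word_span n x /\ x j = a.

Lemma word_seq D' (B : tensor C d D') N (s : config d N) :
  word B s = \prod_(i <- [seq s k | k <- enum 'I_N]) B i.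
Proof. by rewrite big_map enumT /word /index_enum; case: index_enum_key. Qed.

Lemma normal_full j : normal_CFII (A j) ->
  exists L, forall n, (L <= n)%N -> full_at n j.
Proof.
move=> [[[L _ sp] _] tp _]; exists L => n /subnK <-.
elim: (n - L)%N => [|p IH] a; rewrite ?add0n ?addSn.
  set X := in_tuple [seq word (A j) s | s : config d L].
  have /coord_span -> : a \in <<X>>%VS by rewrite sp memvf.
  have hX (i : 'I_(size X)) : exists s : config d L, X`_i = word (A j) s.
    have /fintype.imageP[s _ e] : X`_i \in [seq word (A j) s | s : config d L].
      exact: mem_nth.
    by exists s.
  have [w hw] := choice hX.
  exists (fun l => \sum_i coord X i a *: word (A l) (w i)); split; last first.
    by apply: eq_bigr => i _; rewrite hw.
  apply: word_span_sum => i; apply: word_spanZ.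
  have := word_span_seq A [seq w i k | k <- enum 'I_L].
  rewrite size_map size_enum_ord => /eq_word_span; apply=> l.
  by rewrite word_seq.
(* The length grows by one because [a] is the sum over [i] of [a *m (A j i)^t* *m A j i], by trace
   preservation. *)
have [x hx] := choice (fun i => IH (a *m (A j i)^t*)).
exists (fun l => \sum_i x i l *m A l i); split.
  apply: word_span_sum => i; rewrite -addn1.
  by apply: word_spanM (hx i).1 (word_span_letter A i).
under eq_bigr do rewrite (hx _).2 -mulmxA.
by rewrite -mulmx_sumr trace_preserving_sum // mulmx1.
Qed.

(* Full matrix algebras are simple: the two-sided ideal generated by a nonzero
   [x j] contains the identity. *)
Lemma span_unit j L n x : full_at L j -> word_span n x -> x j != 0 ->
  exists e, [/\ word_span (L + n + L) e, e j = 1%:M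
              & forall l, x l = 0 -> e l = 0].
Proof.
move=> fL hx /mx_neq0_entry[p [q xpq]].
have [a ha] := choice (fun r => fL (delta_mx r p)).
have [b hb] := choice (fun r => fL (delta_mx q r)).
exists (fun l => (x j p q)^-1 *: \sum_r (a r l *m x l *m b r l)); split.
- apply: word_spanZ; apply: word_span_sum => r.
  by apply: word_spanM (hb r).1; apply: word_spanM (ha r).1 hx.
- under eq_bigr => r _ do rewrite (ha r).2 (hb r).2 mul_delta_delta.
  rewrite -scaler_sumr scalerA mulVf // scale1r.
  apply/matrixP => s t; rewrite summxE mxE (bigD1 s) //= big1 ?addr0 => [|k nk].
    by rewrite mxE eqxx /= eq_sym.
  by rewrite mxE eq_sym (negPf nk).
- by move=> l xl; rewrite big1 ?scaler0 // => r _; rewrite xl mulmx0 mul0mx.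
Qed.

(* If no element of the joint word span separates block [j] from block [k],
   the span is the graph of a graded isomorphism of matrix algebras, and the
   Skolem-Noether argument produces a gauge transformation. *)
Section Intertwiner.
Variables (j k : 'I_m) (L : nat).
Hypothesis one_j : (1%:M : 'M[C]_(D j)) != 0.
Hypothesis full_j : forall n, (L <= n)%N -> full_at n j.
Hypothesis full_k : forall n, (L <= n)%N -> full_at n k.
Hypothesis inj_jk : forall n x, word_span n x -> x k = 0 -> x j = 0.

(** Otherwise some [e] is 1 in block [k] and 0 in block [j]. Subtracting a suitable multiple of [e]
    from an element that is 1 in block [j] kills its [k] component and keeps the 1, against
    [inj_jk]. *)
Lemma inj_kj n x : word_span n x -> x j = 0 -> x k = 0.
Proof.
move=> hx xj; apply/eqP/negPn/negP => xk.
have [e [he ek /(_ j xj) ej]] := span_unit (full_k (leqnn L)) hx xk.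
have [y [hy yj]] := full_j (leq_addl (L + n + L) L) 1%:M.
have [z [hz zk]] := full_k (leqnn L) (y k).
have := inj_jk (word_spanB hy (word_spanM he hz)).
rewrite ek zk mul1mx subrr ej mul0mx subr0 yj => /(_ erefl) e1.
by move: one_j; rewrite e1 eqxx.
Qed.

Lemma inj_kj_eq n x y : word_span n x -> word_span n y -> x j = y j -> x k = y k.
Proof.
move=> hx hy e; apply/eqP; rewrite -subr_eq0; apply/eqP.
by apply: (inj_kj (word_spanB hx hy)); rewrite e subrr.
Qed.

(** Block [j] determines block [k], so [u k] inherits from [u j = 1] that it commutes with every
    matrix. *)
Lemma span1_scalar n u : word_span n u -> u j = 1%:M ->
  exists2 c, c != 0 & u k = c%:M.
Proof.
move=> hu uj.
have [|c uc] := @commutes_all_scalar _ _ (u k).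
  move=> a; have [x [hx <-]] := full_k (leqnn L) a.
  apply: (@inj_kj_eq (n + L)%N (fun l => u l *m x l) (fun l => x l *m u l)).
  - exact: word_spanM.
  - by rewrite addnC; apply: word_spanM.
  - by rewrite uj mul1mx mulmx1.
exists c => //; apply: contraNneq one_j => c0.
by rewrite -uj (inj_jk hu) // uc c0 raddf0.
Qed.

(** Column [p] of [V] is column [b] of [y p k], where [y p] realises the matrix unit [(p, p0)] in
    block [j]: the left ideal of column [p0] is carried over to block [k]. The factor [u k] makes
    the word lengths on both sides agree. *)
Lemma intertwiner_exists : exists2 V : 'M[C]_(D k, D j), V != 0 &
  forall n x u, word_span n x -> word_span n u -> u j = 1%:M ->
    x k *m V = u k *m V *m x j.
Proof.
have [p0 [_ _]] := mx_neq0_entry one_j.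
have [y hy] := choice (fun p => full_j (leqnn L) (delta_mx p p0)).
have y0 : y p0 k != 0.
  apply: contraNneq one_j => /(inj_jk (hy p0).1).
  rewrite (hy p0).2 => /matrixP/(_ p0 p0); rewrite !mxE !eqxx => /eqP.
  by rewrite oner_eq0.
have [r [b yrb]] := mx_neq0_entry y0.
exists (\matrix_(r, p) y p k r b).
  by apply: contraNneq yrb => /matrixP/(_ r p0); rewrite !mxE => ->.
move=> n x u hx hu uj; apply/matrixP => s p.
have E : x k *m y p k = \sum_q x j q p *: (u k *m y q k).
  apply: (@inj_kj_eq (n + L)%N (fun l => x l *m y p l)
    (fun l => \sum_q x j q p *: (u l *m y q l))).
  - exact: word_spanM hx (hy p).1.
  - apply: word_span_sum => q; apply: word_spanZ.
    exact: word_spanM hu (hy q).1.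
  - rewrite (hy p).2; under eq_bigr do rewrite (hy _).2 uj mul1mx.
    apply/matrixP => t t'; rewrite mxE summxE (bigD1 p) //= big1 ?addr0.
      rewrite (bigD1 t) //= big1 ?addr0 => [|q nq].
        by rewrite !mxE !eqxx.
      by rewrite !mxE eq_sym (negPf nq) mulr0.
    by move=> q nq; rewrite !mxE (negPf nq) mulr0.
have /matrixP/(_ s b) := E; rewrite summxE mxE => E'.
rewrite !mxE; under eq_bigr do rewrite mxE.
rewrite E'; apply: eq_bigr => q _; rewrite !mxE mulrC; congr (_ * _).
by apply: eq_bigr => t _; rewrite mxE.
Qed.

Lemma intertwiner_gauge : exists (V : 'M[C]_(D k, D j)) (W : 'M[C]_(D j, D k)) c,
  [/\ V *m W = 1%:M, W *m V = 1%:M & forall i, A j i = c *: (W *m A k i *m V)].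
Proof.
have [V V0 hV] := intertwiner_exists.
have [a [b Vab]] := mx_neq0_entry V0.
have [u [hu uj]] := full_j (leqnn L) 1%:M.
have [u' [hu' u'j]] := full_j (leqnSn L) 1%:M.
have [c c0 uc] := span1_scalar hu uj.
have [c' c'0 u'c] := span1_scalar hu' u'j.
have hV' x : word_span L x -> x k *m V = c *: (V *m x j).
  by move=> hx; rewrite (hV _ _ _ hx hu uj) uc mul_scalar_mx scalemxAl.
have [x1 hx1] := choice (fun p => full_j (leqnn L) (delta_mx b p)).
have [x2 hx2] := choice (fun p => full_k (leqnn L) (delta_mx p a)).
(* Row [a] of [hV'] at the matrix units [(b, p)] of block [j] gives a left inverse of [V]; column
   [b] of [hV'] at the matrix units [(p, a)] of block [k] gives a right inverse. *)
pose W := \matrix_(p, s) (c^-1 * (V a b)^-1 * x1 p k a s).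
pose W' := \matrix_(s, p) (c * (V a b)^-1 * x2 p j s b).
have WV : W *m V = 1%:M.
  apply/matrixP => p q; rewrite !mxE.
  have /matrixP/(_ a q) := hV' _ (hx1 p).1.
  rewrite (hx1 p).2 !mxE (bigD1 b) //= [X in _ * (_ + X)]big1 ?addr0 => [E|t nt]; last first.
    by rewrite mxE (negPf nt) mulr0.
  under eq_bigr do rewrite mxE -mulrA.
  by rewrite -mulr_sumr E mxE eqxx [q == p]eq_sym /= -mulrA mulrCA mulKf // mulKf.
have VW' : V *m W' = 1%:M.
  apply/matrixP => q p; rewrite !mxE.
  have /matrixP/(_ q b) := hV' _ (hx2 p).1.
  rewrite (hx2 p).2 !mxE (bigD1 a) //= big1 ?addr0 => [E|t nt]; last first.
    by rewrite mxE (negPf nt) andbF mul0r.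
  under eq_bigr do rewrite mxE mulrCA [c * _]mulrC -mulrA.
  rewrite -!mulr_sumr -E mxE eqxx andbT mulrCA mulVf //= mulr1 //.
have VW : V *m W = 1%:M.
  by rewrite -{1}[W]mulmx1 -VW' [W *m _]mulmxA WV mul1mx VW'.
(* The scalars [c] and [c'] represent the identity of block [j] at lengths [L] and [L.+1]; a single
   letter passes from one length to the other, whence their ratio. *)
exists V, W, (c / c'); split => // i.
have := hV _ _ _ (word_spanM (word_span_letter A i) hu).
move=> /(_ u' hu' u'j); rewrite uj mulmx1 uc u'c -!mulmxA mul_scalar_mx.
rewrite -scalemxAr mul_scalar_mx => E.
by rewrite [c / c']mulrC -scalerA scalemxAr E -scalemxAr scalerA mulVf // scale1r
  mulmxA WV mul1mx.
Qed.

End Intertwiner.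

Hypothesis CFII : forall j, normal_CFII (A j).
Hypothesis non_gauge_equiv : forall j k, gauge_phase_equiv (A j) (A k) -> j = k.

(** If nothing separates the blocks, [span_unit] yields the hypothesis [inj_jk], hence a gauge
    transformation up to a constant, which must be a phase. *)
Lemma separate_pair j k : j != k ->
  exists n e, [/\ word_span n e, e j = 1%:M & e k = 0].
Proof.
move=> jk; apply: contrapT => no.
have [Lj full_j] := normal_full (CFII j).
have [Lk full_k] := normal_full (CFII k).
have [] := @intertwiner_gauge j k (maxn Lj Lk).
- by have [/normal_tensor1_neq0] := CFII j.
- by move=> n; rewrite geq_max => /andP[/full_j].
- by move=> n; rewrite geq_max => /andP[_ /full_k].
- move=> n x hx xk; apply: contrapT => /eqP xj; apply: no.
  have [e [he ej /(_ k xk) ek]] := span_unit (full_j _ (leqnn Lj)) hx xj.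
  by exists (Lj + n + Lj)%N, e.
move=> V [W [c [VW WV hA]]].
move/eqP: jk; apply; apply: non_gauge_equiv; exists V, W, c; split => //.
exact: gauge_equiv_norm1 (CFII j) (CFII k) VW hA.
Qed.

(** The product of the pairwise separators is 1 in block [j] and 0 elsewhere; a further factor from
    [normal_full] reaches any value [a] and any large length. *)
Lemma separate_block j : exists N, forall n a, (N <= n)%N ->
  exists x, [/\ word_span n x, x j = a & forall k, k != j -> x k = 0].
Proof.
suff [n0 [e [he ej e0]]] : exists n e, [/\ word_span n e, e j = 1%:M &
    forall k, k != j -> e k = 0].
  have [L fullj] := normal_full (CFII j).
  exists (n0 + L)%N => n a nL.
  have [|x [hx xj]] := fullj (n - n0)%N _ a.
    by rewrite leq_subRL // (leq_trans _ nL) ?leq_addr.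
  exists (fun l => e l *m x l); split.
  - have := word_spanM he hx; rewrite subnKC // (leq_trans _ nL) ?leq_addr //.
  - by rewrite ej mul1mx.
  - by move=> k kj; rewrite e0 // mul0mx.
suff H (s : seq 'I_m) : exists n e, [/\ word_span n e, e j = 1%:M &
    forall k, k \in s -> k != j -> e k = 0].
  have [n [e [he ej e0]]] := H (enum 'I_m); exists n, e; split => // k.
  by apply: e0; rewrite mem_enum.
elim: s => [|l s [n [e [he ej e0]]]].
  by exists 0%N, (fun=> 1%:M); split => //; apply: word_span1.
have [->|lj] := eqVneq l j.
  by exists n, e; split => // k; rewrite inE => /orP[/eqP->|/e0//]; rewrite eqxx.
have [|n' [f [hf fj fl]]] := @separate_pair j l; first by rewrite eq_sym.
exists (n + n')%N, (fun k => e k *m f k); split.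
- exact: word_spanM.
- by rewrite ej fj mul1mx.
- move=> k; rewrite inE => /orP[/eqP->|/e0 h /h ->]; last by rewrite mul0mx.
  by rewrite fl mulmx0.
Qed.

Lemma trace_word_eq0 j : exists N, forall n (M : forall j, 'M[C]_(D j)),
    (N <= n)%N ->
    (forall s : seq 'I_d, size s = n ->
       \sum_k \tr (M k *m \prod_(i <- s) A k i) = 0) ->
  M j = 0.
Proof.
have [N hN] := separate_block j; exists N => n M nN h.
apply: trace_mul_eq0 => a; have [x [hx xj x0]] := hN n a nN.
have := trace_word_span_eq0 hx h; rewrite (bigD1 j) //= xj big1 ?addr0 //.
by move=> k kj; rewrite x0 // mulmx0 mxtrace0.
Qed.

End Separation.

(** * Algebra of block-diagonal matrices *)

Section DirectSum.
Variables (C : numClosedFieldType) (m : nat) (r D : 'I_m -> nat).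
Implicit Types M N : forall j, 'I_(r j) -> 'M[C]_(D j).

Lemma mul_mxdiag n (p : 'I_n -> nat) (M N : forall i, 'M[C]_(p i)) :
  \mxdiag_i M i *m \mxdiag_i N i = \mxdiag_i (M i *m N i).
Proof.
rewrite [in LHS]/mxdiag mul_mxdiag_mxblock; apply/eq_mxblock => i j.
by case: eqVneq => [<-|]; rewrite ?conform_mx_id ?mulmx0.
Qed.

Lemma dsumM M N : dsum M *m dsum N = dsum (fun j q => M j q *m N j q).
Proof. by rewrite mul_mxdiag; apply: eq_mxdiag => j; rewrite mul_mxdiag. Qed.

Lemma eq_dsum M N : (forall j q, M j q = N j q) -> dsum M = dsum N.
Proof. by move=> e; apply: eq_mxdiag => j; apply: eq_mxdiag. Qed.

Lemma dsum1 : dsum (fun j (q : 'I_(r j)) => 1%:M : 'M[C]_(D j)) = 1%:M.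
Proof. by rewrite /dsum -mxdiagZ; apply: eq_mxdiag => j; rewrite mxdiagZ. Qed.

Lemma dsum_sum (I : finType) (M : I -> forall j, 'I_(r j) -> 'M[C]_(D j)) :
  dsum (fun j q => \sum_i M i j q) = \sum_i dsum (M i).
Proof. by rewrite /dsum -mxdiag_sum; apply: eq_mxdiag => j; rewrite mxdiag_sum. Qed.

Lemma dsumB M N : dsum M - dsum N = dsum (fun j q => M j q - N j q).
Proof. by rewrite /dsum -mxdiagB; apply: eq_mxdiag => j; rewrite mxdiagB. Qed.

Lemma dsumZ a M : dsum (fun j q => a *: M j q) = a *: dsum M.
Proof.
rewrite -mul_scalar_mx -mxdiagZ mul_mxdiag; apply: eq_mxdiag => j.
by rewrite -mxdiagZ mul_mxdiag; apply: eq_mxdiag => q; rewrite mul_scalar_mx.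
Qed.

Lemma adj_mxdiag n (p : 'I_n -> nat) (M : forall i, 'M[C]_(p i)) :
  (\mxdiag_i M i)^t* = \mxdiag_i (M i)^t*.
Proof.
rewrite tr_mxdiag; apply/matrixP => s t; rewrite !mxE.
case: eqVneq => [|_]; last by rewrite !mxE rmorph0.
(* Destructing the equality of block indices turns the size cast [conform_mx] into the identity. *)
move: (tagnat.sig1 t) (tagnat.sig2 t) => k u e; case: k / e u => u.
by rewrite !conform_mx_id !mxE.
Qed.

Lemma adj_dsum M : (dsum M)^t* = dsum (fun j q => (M j q)^t*).
Proof. by rewrite adj_mxdiag; apply: eq_mxdiag => j; rewrite adj_mxdiag. Qed.

Lemma trace_dsum M : \tr (dsum M) = \sum_j \sum_q \tr (M j q).
Proof. by rewrite mxtrace_mxdiag; apply: eq_bigr => j _; rewrite mxtrace_mxdiag. Qed.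

Lemma prod_dsum d (B : forall j, tensor C d (D j)) (mu : forall j, 'I_(r j) -> C)
    (s : seq 'I_d) :
  \prod_(i <- s) dsum (fun j q => mu j q *: B j i) =
  dsum (fun j q => mu j q ^+ size s *: \prod_(i <- s) B j i).
Proof.
elim: s => [|i s IH].
  rewrite big_nil -[LHS]dsum1; apply: eq_dsum => j q.
  by rewrite big_nil expr0 scale1r.
rewrite big_cons IH -[LHS]/(_ *m _) dsumM; apply: eq_dsum => j q /=.
by rewrite big_cons exprS -scalemxAl -scalemxAr scalerA.
Qed.

End DirectSum.

(** * Action of an operator on the physical index *)

Section Mix.
Variables (C : numClosedFieldType) (d D : nat).
Implicit Types (U : 'M[C]_d) (B : tensor C d D).

Definition mix U B : tensor C d D := fun i => \sum_k U i k *: B k.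

Lemma mix_mul U U' B i : mix (U *m U') B i = mix U (mix U' B) i.
Proof.
rewrite /mix; under eq_bigr do rewrite mxE scaler_suml.
rewrite exchange_big; apply: eq_bigr => k _ /=; rewrite scaler_sumr.
by apply: eq_bigr => l _; rewrite scalerA.
Qed.

Lemma mix1 B i : mix 1%:M B i = B i.
Proof.
rewrite /mix (bigD1 i) //= big1 ?addr0 => [|k nk]; rewrite mxE.
  by rewrite eqxx scale1r.
by rewrite eq_sym (negPf nk) scale0r.
Qed.

Lemma mixZ a U B i : mix (a *: U) B i = a *: mix U B i.
Proof. by rewrite /mix scaler_sumr; apply: eq_bigr => k _; rewrite mxE scalerA. Qed.

Lemma mix_mulr U B (X : 'M[C]_D) i : mix U (fun k => B k *m X) i = mix U B i *m X.
Proof. by rewrite /mix mulmx_suml; apply: eq_bigr => k _; rewrite scalemxAl. Qed.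

Lemma mix_mull U B (X : 'M[C]_D) i : mix U (fun k => X *m B k) i = X *m mix U B i.
Proof. by rewrite /mix mulmx_sumr; apply: eq_bigr => k _; rewrite scalemxAr. Qed.

Lemma eq_mix U B B' i : (forall k, B k = B' k) -> mix U B i = mix U B' i.
Proof. by move=> e; apply: eq_bigr => k _; rewrite e. Qed.

(** Summation over [i] contracts [U] with its conjugate to the identity. *)
Lemma mix_adj_sum U B : U \is unitarymx ->
  \sum_i (mix U B i)^t* *m mix U B i = \sum_i (B i)^t* *m B i.
Proof.
move=> /unitarymxP/mulmx1C UU.
under eq_bigr => i _ do rewrite {1}/mix adjmx_sum mulmx_suml.
rewrite exchange_big; apply: eq_bigr => k _ /=.
under eq_bigr => i _ do rewrite adjmxZ -scalemxAl scalemxAr.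
rewrite -mulmx_sumr; congr (_ *m _); rewrite -[RHS]mix1 -UU mix_mul.
by apply: eq_bigr => i _; rewrite !mxE.
Qed.

End Mix.

(** * The symmetry on a single normal block *)

Section Block.
Variables (C : numClosedFieldType) (d D : nat) (B : tensor C d D).
Hypothesis CFII : normal_CFII B.

Lemma left_cancel (Z : 'M[C]_D) : (forall i, B i *m Z = 0) -> Z = 0.
Proof.
move=> BZ; have [_ /trace_preserving_sum tp _] := CFII.
rewrite -[Z]mul1mx -tp mulmx_suml big1 // => i _.
by rewrite -mulmxA BZ mulmx0.
Qed.

(** [Z] annihilates the fixed point of [cp_map B], a diagonal matrix with positive entries. *)
Lemma right_cancel (Z : 'M[C]_D) : (forall i, Z *m B i = 0) -> Z = 0.
Proof.
move=> ZB; have [_ _ [lam lam0 fixB]] := CFII.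
have : Z *m diag_mx lam = 0.
  rewrite -fixB /cp_map mulmx_sumr big1 // => i _.
  by rewrite !mulmxA ZB !mul0mx.
move=> /matrixP ZL; apply/matrixP => p q; have := ZL p q.
rewrite mul_mx_diag !mxE => /eqP; rewrite mulf_eq0 => /orP[/eqP//|/eqP l0].
by have := lam0 q; rewrite l0 ltxx.
Qed.

(* With [R] standing for $\mathcal{R}(g)$, this is the matrix $X_j(g)$. *)
Definition push (R : 'M[C]_d) : 'M[C]_D := \sum_i (B i)^t* *m mix R B i.

Variables (R L : 'M[C]_d).
Hypotheses (unitR : R \is unitarymx) (unitL : L \is unitarymx).
Hypothesis symRL : forall a b, mix R B a *m mix L B b = B a *m B b.

Lemma push_mixl b : push R *m mix L B b = B b.
Proof.
have [_ /trace_preserving_sum tp _] := CFII.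
rewrite /push mulmx_suml -[RHS]mul1mx -tp mulmx_suml.
by apply: eq_bigr => i _; rewrite -!mulmxA symRL.
Qed.

Lemma mixr_push a : mix R B a = B a *m push R.
Proof.
apply/eqP; rewrite -subr_eq0; apply/eqP/right_cancel => i.
(* Since [L] is unitary, [B i] is a combination of the [mix L B k], and multiplied by each of these
   the two sides agree. *)
rewrite -[B i]mix1 -(mulmx1C (unitarymxP unitL)) mix_mul -mix_mull.
rewrite /mix big1 // => k _; rewrite mulmxBl symRL -mulmxA push_mixl subrr.
by rewrite scaler0.
Qed.

(** Substituting [mixr_push] into the sum preserved by [mix_adj_sum] turns the identity into
    [push R] multiplied on the left by its adjoint. *)
Lemma push_unitary : push R \is unitarymx.
Proof.
have [_ /trace_preserving_sum tp _] := CFII.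
apply/unitarymxP; apply: mulmx1C; rewrite -[RHS]tp -(mix_adj_sum B unitR).
under [RHS]eq_bigr => i _.
  rewrite mixr_push adjmxM -mulmxA [(B i)^t* *m _]mulmxA; over.
by rewrite -mulmx_sumr -mulmx_suml tp mul1mx.
Qed.

End Block.

(** * Continuity of matrix-valued maps *)

Section Continuity.
Variables (C : numClosedFieldType) (T : topologicalType).

Lemma continuous_mx m n (f : T -> 'M[C]_(m, n)) :
  (forall p q, continuous (fun x => f x p q)) -> continuous f.
Proof.
move=> cf x A [P hP sPA].
apply: (@filterS _ _ _ [set y | forall p q, P p q (f y p q)]).
  by move=> y; apply: sPA.
by apply: filter_forall => p; apply: filter_forall => q; apply: cf.
Qed.

Lemma continuous_sum_scale (I : finType) m n (c : T -> I -> C) (K : I -> 'M[C]_(m, n)) :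
  (forall i, continuous (c^~ i)) -> continuous (fun x => \sum_i c x i *: K i).
Proof.
move=> cc; apply: continuous_mx => p q x.
have -> : (fun x => (\sum_i c x i *: K i) p q) = (fun x => \sum_i c x i * K i p q).
  by apply/funext => y; rewrite summxE; apply: eq_bigr => i _; rewrite mxE.
apply: cvg_big => [|i _]; first exact: add_continuous.
by apply: cvgM; [exact: cc|exact: cvg_cst].
Qed.


End Continuity.

(** * From the symmetry of the state to each block *)

Section LocalSymmetry.
Variables (C : numClosedFieldType) (d m : nat) (r D : 'I_m -> nat).
Variables (A : forall j, tensor C d (D j)) (mu : forall j, 'I_(r j) -> C).
Variable B : tensor C d (\sum_(j < m) \sum_(q < r j) D j).
Hypothesis r_gt0 : forall j, (0 < r j)%N.
Hypothesis mu_neq0 : forall j (q : 'I_(r j)), mu q != 0.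
Hypothesis BE : forall i, B i = dsum (fun j q => mu q *: A j i).

Lemma word_two_letters (E : nat) (T : tensor C d E) n (u : config d n.+2) a
    (s : seq 'I_d) :
    size s = n -> (forall k : 'I_n, u (lift ord0 (lift ord0 k)) = nth a s k) ->
  word T u = T (u ord0) *m (T (u (lift ord0 ord0)) *m \prod_(i <- s) T i).
Proof.
move=> ss hu; rewrite /word big_ord_recl big_ord_recl; congr (_ *m (_ *m _)).
rewrite (big_nth a) ss big_mkord; apply: eq_bigr => k _.
by rewrite hu.
Qed.

Lemma trace_mixed_words (R L : 'M[C]_d) n a b (s : seq 'I_d) : size s = n ->
    site_op R (ord0 : 'I_n.+2) (site_op L (ordS ord0) (mpv B n.+2)) = mpv B n.+2 ->
  \tr (mix R B a *m (mix L B b *m \prod_(i <- s) B i)) =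
  \tr (B a *m (B b *m \prod_(i <- s) B i)).
Proof.
(* The symmetry at sites 0 and 1 is read off at the configuration [a, b, s]. The default [a] of
   [nth] is never reached, as the list has length [n.+2]. *)
move=> ss sym; pose f : config d n.+2 := [ffun k => nth a [:: a, b & s] (val k)].
have o1 : ordS ord0 = lift ord0 ord0 :> 'I_n.+2.
  by apply: val_inj; rewrite /= modn_small.
have := congr1 (fun psi : state C d n.+2 => psi f) sym.
rewrite !ffunE (@word_two_letters _ _ _ _ a s ss) => [|k]; last by rewrite ffunE.
rewrite !ffunE /= => <-; rewrite {1}/mix mulmx_suml raddf_sum.
apply: eq_bigr => a' _ /=; rewrite !ffunE -scalemxAl mxtraceZ; congr (_ * _).
rewrite /mix mulmx_suml mulmx_sumr raddf_sum.
apply: eq_bigr => b' _ /=; rewrite !ffunE o1 /= -scalemxAl -scalemxAr mxtraceZ.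
congr (_ * _); rewrite (@word_two_letters _ _ _ _ a s ss) => [|k]; last by rewrite !ffunE.
by rewrite !ffunE.
Qed.

(** Two powers of [mu q] come from the two letters acted upon and [size s] from the rest of the
    word. *)
Lemma trace_blocks (X : forall j, 'M[C]_(D j)) (s : seq 'I_d) :
  \tr (dsum (fun j q => mu q ^+ 2 *: X j) *m \prod_(i <- s) B i) =
  \sum_j \tr ((\sum_(q < r j) mu q ^+ (size s).+2) *: X j *m \prod_(i <- s) A j i).
Proof.
rewrite (eq_bigr _ (fun i _ => BE i)) prod_dsum dsumM trace_dsum.
apply: eq_bigr => j _; rewrite -scalemxAl mxtraceZ mulr_suml.
apply: eq_bigr => q _; rewrite -scalemxAl -scalemxAr scalerA mxtraceZ.
by rewrite -exprD.
Qed.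

Hypothesis CFII : forall j, normal_CFII (A j).
Hypothesis non_gauge_equiv : forall j k, gauge_phase_equiv (A j) (A k) -> j = k.

Lemma mix_dsum U i : mix U B i = dsum (fun j q => mu q *: mix U (A j) i).
Proof.
transitivity (\sum_k dsum (fun j (q : 'I_(r j)) => U i k *: (mu q *: A j k))).
  by apply: eq_bigr => k _; rewrite BE -dsumZ.
rewrite -dsum_sum; apply: eq_dsum => j q; rewrite scaler_sumr.
by apply: eq_bigr => k _; rewrite !scalerA mulrC.
Qed.

Lemma local_block_symmetry (R L : 'M[C]_d) :
    (forall n, site_op R (ord0 : 'I_n.+2) (site_op L (ordS ord0) (mpv B n.+2)) =
               mpv B n.+2) ->
  forall j a b, mix R (A j) a *m mix L (A j) b = A j a *m A j b.
Proof.
move=> sym j a b.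
have [N hN] := trace_word_eq0 CFII non_gauge_equiv j.
(* An exponent of at least [N.+2] leaves a word of length at least [N] after the two sites of the
   symmetry. *)
have [n nN mu0] := power_sum_neq0 (Ordinal (r_gt0 j)) N.+2 (@mu_neq0 j).
case: n nN mu0 => [|[|n]] // nN mu0.
pose X l := mix R (A l) a *m mix L (A l) b - A l a *m A l b.
have := hN n (fun l => (\sum_(q < r l) mu q ^+ n.+2) *: X l) nN.
move=> H; apply/eqP; rewrite -subr_eq0 -/(X j).
suff /H/eqP : forall s : seq 'I_d, size s = n ->
    \sum_k \tr ((\sum_(q < r k) mu q ^+ n.+2) *: X k *m \prod_(i <- s) A k i) = 0.
  by rewrite scaler_eq0 (negPf mu0).
move=> s ss; rewrite -ss -trace_blocks.
have -> : dsum (fun j (q : 'I_(r j)) => mu q ^+ 2 *: X j) =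
    mix R B a *m mix L B b - B a *m B b.
  rewrite !mix_dsum !BE !dsumM dsumB; apply: eq_dsum => l q.
  by rewrite -!scalemxAl -!scalemxAr !scalerA -scalerBr.
by rewrite mulmxBl raddfB /= -!mulmxA (trace_mixed_words _ _ ss) ?subrr.
Qed.

End LocalSymmetry.

(** * Assembly of the projective representation *)

Theorem theorem2 (R : realType) (G : topGroupType)
  (hG : finite_discrete_group G \/ compact_Lie_group R G)
  (d : nat) (gam : G -> G -> R[i]) (hgam : multiplier gam)
  (Rep Lep : G -> 'M[R[i]]_d)
  (hR : proj_rep gam Rep)
  (hL : proj_rep (fun g h => (gam g h)^-1) Lep)
  (m : nat) (r : 'I_m -> nat) (hr : forall j, (0 < r j)%N)
  (D : 'I_m -> nat) (Bj : forall j, tensor R[i] d (D j))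
  (mu : forall j, 'I_(r j) -> R[i]) (hmu : forall j q, mu j q != 0)
  (B : tensor R[i] d (\sum_(j < m) \sum_(q < r j) D j))
  (hB : forall i, B i = dsum (fun j q => mu j q *: Bj j i))
  (hCFII : forall j, normal_CFII (Bj j))
  (hBNT : BNT (fun k : {j : 'I_m & 'I_(r j)} => Bj (tag k)) Bj)
  (hsym : forall (N : nat) (K : 'I_N) (g : G), (2 <= N)%N ->
    site_op (Rep g) K (site_op (Lep g) (ordS K) (mpv B N)) = mpv B N) :
  exists Xj : forall j, G -> 'M[R[i]]_(D j),
    let X g := dsum (fun j (_ : 'I_(r j)) => Xj j g) in
    [/\ proj_rep gam X,
        continuous_rep Rep -> continuous_rep Lep -> continuous_rep X,
        forall g i, \sum_i' Rep g i i' *: B i' = B i *m X g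
      & forall g i, \sum_i' Lep g i i' *: B i' = invmx (X g) *m B i].
Proof.
have bnt_inj j k : gauge_phase_equiv (Bj j) (Bj k) -> j = k.
  (* The first copy of [Bj j] is equivalent to [Bj j] itself and to [Bj k]; uniqueness in the basis
     identifies the two indices. *)
  have [j0 [_ uniq_j0]] := hBNT.2 (Tagged _ (Ordinal (hr j))).
  by move=> /uniq_j0 <-; apply/esym/uniq_j0; apply: gauge_phase_equiv_refl.
have sym g j a b :
    mix (Rep g) (Bj j) a *m mix (Lep g) (Bj j) b = Bj j a *m Bj j b.
  by apply: (local_block_symmetry hr hmu hB hCFII bnt_inj) => n; apply: hsym.
pose X j g := push (Bj j) (Rep g).
have RX j g i : mix (Rep g) (Bj j) i = Bj j i *m X j g.
  by apply: mixr_push (sym g j) i; [exact: hCFII | exact: hL.1].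
have LX j g i : X j g *m mix (Lep g) (Bj j) i = Bj j i.
  by apply: push_mixl (sym g j) i; exact: hCFII.
have unitX j g : X j g \is unitarymx.
  by apply: push_unitary (sym g j); [exact: hCFII | exact: hR.1 | exact: hL.1].
have mulX j g h : X j g *m X j h = gam g h *: X j (g * h)%g.
  apply/eqP; rewrite -subr_eq0; apply/eqP/(left_cancel (hCFII j)) => i.
  (* Applied to [Bj j i], both sides become the action of [Rep g *m Rep h] on the physical index, so
     [X] inherits the multiplier. *)
  rewrite mulmxBr mulmxA -RX -mix_mulr.
  rewrite (eq_mix _ _ (fun k => esym (RX j h k))) -mix_mul hR.2 mixZ RX.
  by rewrite scalemxAr subrr.
have unit_dsum g : dsum (fun j (_ : 'I_(r j)) => X j g) \is unitarymx.
  apply/unitarymxP; rewrite adj_dsum dsumM -[RHS]dsum1.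
  by apply: eq_dsum => j q; apply/unitarymxP.
exists X; split.
- split=> // g h; rewrite dsumM -dsumZ.
  by apply: eq_dsum => j q; apply: mulX.
- move=> cR _.
  (* [X g] is a combination of constant matrices with the entries of [Rep g] as coefficients. *)
  rewrite (_ : (fun g => _) = (fun g => \sum_(p : 'I_d * 'I_d) Rep g p.1 p.2 *:
    dsum (fun j (_ : 'I_(r j)) => (Bj j p.1)^t* *m Bj j p.2))).
    apply: continuous_sum_scale => p g.
    exact: (continuous_comp (cR g) (@coord_continuous _ _ _ p.1 p.2 (Rep g))).
  apply/funext => g; transitivity (\sum_(p : 'I_d * 'I_d)
      dsum (fun j (_ : 'I_(r j)) => Rep g p.1 p.2 *: ((Bj j p.1)^t* *m Bj j p.2))).
    rewrite -dsum_sum; apply: eq_dsum => j q.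
    rewrite /X /push.
    rewrite -(pair_bigA _ (fun a b => Rep g a b *: ((Bj j a)^t* *m Bj j b))) /=.
    apply: eq_bigr => a _; rewrite /mix mulmx_sumr.
    by apply: eq_bigr => b _; rewrite scalemxAr.
  by apply: eq_bigr => p _; rewrite dsumZ.
- move=> g i; rewrite -/(mix _ _ _) (mix_dsum hB) hB dsumM.
  by apply: eq_dsum => j q; rewrite RX scalemxAl.
- move=> g i; rewrite -/(mix _ _ _).
  apply: (canRL (mulKmx (unitarymx_unit (unit_dsum g)))).
  rewrite (mix_dsum hB) hB dsumM; apply: eq_dsum => j q.
  by rewrite -scalemxAr LX.
Qed.
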